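(* Let $I=\{1,2\}$. For each of the following six pairs $A_\pm(z)=(A_+(z),A_-(z))\in\mathbb{Y}$, the associated Y-system is positive reddening and negative reddening: (1) $A_+(z)=\begin{pmatrix}1+z^2&-z\\-z&1+z^2\end{pmatrix}$, $A_-(z)=\begin{pmatrix}1+z^2&0\\0&1+z^2\end{pmatrix}$; (2) $A_+(z)=\begin{pmatrix}1+z^2&-z\\-z-z^5&1+z^6\end{pmatrix}$, $A_-(z)=\begin{pmatrix}1+z^2&0\\-z^3&1+z^6\end{pmatrix}$; (3) $A_+(z)=\begin{pmatrix}1+z^2&-z\\-z-z^5-z^9&1+z^{10}\end{pmatrix}$, $A_-(z)=\begin{pmatrix}1+z^2&0\\-z^3-z^7&1+z^{10}\end{pmatrix}$; (4) $A_+(z)=\begin{pmatrix}1+z^2&-z\\-z&1+z^2\end{pmatrix}$, $A_-(z)=\begin{pmatrix}1+z^2-z&0\\0&1+z^2-z\end{pmatrix}$; (5) $A_+(z)=\begin{pmatrix}1+z^2&-z\\-z-z^2&1+z^3\end{pmatrix}$, $A_-(z)=\begin{pmatrix}1+z^2-z&0\\0&1+z^3\end{pmatrix}$; (6) $A_+(z)=\begin{pmatrix}1+z^2&-z\\-z&1+z^2-z\end{pmatrix}$, $A_-(z)=\begin{pmatrix}1+z^2&0\\0&1+z^2\end{pmatrix}$.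
   Context: **Pairs.** Let $I$ be a finite set, $\mathbb{N}=\{0,1,2,\dots\}$, $[n]_+=\max(0,n)$. $\mathbb{Y}_0$ is the set of pairs $(\boldsymbol r,\boldsymbol n)$ of families of integers $\boldsymbol r=(r_i)_{i\in I}$, $\boldsymbol n=(n_{ij;p})_{i,j\in I,p\in\mathbb{N}}$ with $r_i\ge1$ and $n_{ij;p}=0$ unless $0<p<r_i$. Put $n^\pm_{ij;p}=[\pm n_{ij;p}]_+$ and $$A_\pm(z)=\operatorname{diag}(1+z^{r_i})_{i\in I}-\Bigl(\sum_{p\in\mathbb{N}}n^\pm_{ij;p}z^p\Bigr)_{i,j\in I}.$$ The map $(\boldsymbol r,\boldsymbol n)\mapsto A_\pm(z)=(A_+(z),A_-(z))$ is injective, and $\mathbb{Y}_0$ is identified with its image. $\mathbb{Y}\subseteq\mathbb{Y}_0$ is the subset of pairs with the symplectic property $A_+(z)A_-(z^{-1})^{\mathsf T}=A_-(z)A_+(z^{-1})^{\mathsf T}$. **Y-seeds and mutations.** A semifield is a multiplicative abelian group with an addition that is commutative, associative, and distributive with respect to multiplication. A Y-seed (with finite index set $R$, in a semifield $\mathbb{P}$) is a pair $(B,\boldsymbol y)$ of a skew-symmetric integer matrix $B=(B_{ij})_{i,j\in R}$ and a tuple $\boldsymbol y=(y_i)_{i\in R}$ in $\mathbb{P}$. For $k\in R$, $\mu_k(B,\boldsymbol y)=(B',\boldsymbol y')$ with $B'_{ij}=-B_{ij}$ if $i=k$ or $j=k$, $B'_{ij}=B_{ij}+[-B_{ik}]_+B_{kj}+B_{ik}[B_{kj}]_+$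 otherwise; $y'_k=y_k^{-1}$ and $y'_i=y_iy_k^{[B_{ki}]_+}(1+y_k)^{-B_{ki}}$ for $i\ne k$. Mutations $\mu_i,\mu_j$ commute if $B_{ij}=0$; for a set $\boldsymbol i$ with $B_{ij}=0$ for all $i,j\in\boldsymbol i$, $\mu_{\boldsymbol i}$ is the composite of the $\mu_i$, $i\in\boldsymbol i$. For a bijection $\nu:R\to R$, $\nu(B,\boldsymbol y)=(B',\boldsymbol y')$ with $B'_{\nu(i)\nu(j)}=B_{ij}$, $y'_{\nu(i)}=y_i$. **The sequence attached to $A_\pm(z)$.** Let $R=\{(i,u)\in I\times\mathbb{Z}\mid0\le u<r_i\}$, $\boldsymbol i=\{(i,u)\in R\mid u=0\}$, $\nu(i,p)=(i,p-1)$ if $p>0$, $\nu(i,0)=(i,r_i-1)$, and $$B_{(i,p)(j,q)}=-n_{ij;p-q}+n_{ji;q-p}+\sum_{k\in I}\sum_{v=0}^{\min(p,q)}\bigl(n^+_{ik;p-v}n^-_{jk;q-v}-n^-_{ik;p-v}n^+_{jk;q-v}\bigr),$$ with $n_{ij;p}=n^\pm_{ij;p}=0$ for $p<0$. Then $B$ is skew-symmetric and $\nu(\mu_{\boldsymbol i}(B))=B$. The tropical semifield $\operatorname{Trop}(\boldsymbol y)$ is the free multiplicative abelian group on the variables $\boldsymbol y=(y_r)_{r\in R}$ with addition $\prod_ry_r^{a_r}+\prod_ry_r^{b_r}=\prod_ry_r^{\min(a_r,b_r)}$. The tuples $\boldsymbol y(u)=(y_r(u))_{r\in R}$, $u\in\mathbb{Z}$,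 in $\operatorname{Trop}(\boldsymbol y)$ are defined by $\boldsymbol y(0)=\boldsymbol y$ and $(B,\boldsymbol y(u+1))=\nu(\mu_{\boldsymbol i}(B,\boldsymbol y(u)))$ for all $u\in\mathbb{Z}$. **Reddening.** The Y-system associated with $A_\pm(z)$ is positive (resp. negative) reddening if there is a positive integer $u$ such that for every $r\in R$ all exponents in the monomial $y_r(u)$ (resp. $y_r(-u)$) in $\operatorname{Trop}(\boldsymbol y)$ are nonpositive. *)

(* Defs.v *)
From HB Require Import structures.
From mathcomp Require Import all_boot all_order all_fingroup all_algebra.
From mathcomp Require Import ring zify.
Set Implicit Arguments.
Unset Strict Implicit.
Unset Printing Implicit Defensive.
Import Order.TTheory GRing.Theory Num.Theory.
Local Open Scope ring_scope.

Definition pos_part (m : int) : int := Num.max 0 m.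

Section Pairs.
Variable N : nat.
Implicit Types (r : 'I_N -> nat) (n : 'I_N -> 'I_N -> nat -> int).

Definition in_Y0 r n : Prop :=
  (forall i, (1 <= r i)%N) /\
  (forall i j p, ~~ (0 < p < r i)%N -> n i j p = 0).

Definition npos n i j p : int := pos_part (n i j p).
Definition nneg n i j p : int := pos_part (- n i j p).

(* The sum over all p is finite: on [in_Y0] the terms with p >= r i vanish. *)
Definition A_of r (m : 'I_N -> 'I_N -> nat -> int) : 'M[{poly int}]_N :=
  diag_mx (\row_i (1 + 'X^(r i)))
  - \matrix_(i, j) (\sum_(p < r i) m i j p *: 'X^p).

Definition Apm r n : 'M[{poly int}]_N * 'M[{poly int}]_N :=
  (A_of r (npos n), A_of r (nneg n)).

(* Laurent polynomials are computed in the field of rational functions Z(z). *)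
Definition eval_frac (x : {fraction {poly int}}) (p : {poly int}) :
  {fraction {poly int}} := (map_poly intr p).[x].

Definition symplectic (A : 'M[{poly int}]_N * 'M[{poly int}]_N) : Prop :=
  let z := tofrac 'X in
  let ev x (M : 'M[{poly int}]_N) := map_mx (eval_frac x) M in
  ev z A.1 *m (ev z^-1 A.2)^T = ev z A.2 *m (ev z^-1 A.1)^T.

Definition in_Y (A : 'M[{poly int}]_N * 'M[{poly int}]_N) : Prop :=
  (exists r n, in_Y0 r n /\ Apm r n = A) /\ symplectic A.

Lemma coefA_of r m i j p :
  (A_of r m i j)`_p
  = (if i == j then (p == 0)%N%:R + (p == r i)%:R else 0)
    - (if (p < r i)%N then m i j p else 0).
Proof.
rewrite !mxE coefB coefMn coefD coef1 coefXn; congr (_ - _).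
  by case: (i == j).
by rewrite -poly_def coef_poly.
Qed.

Lemma Apm_inj r n r' n' :
  in_Y0 r n -> in_Y0 r' n' -> Apm r n = Apm r' n' ->
  r =1 r' /\ forall i j p, n i j p = n' i j p.
Proof.
move=> [r1 n0] [r1' n0'] [eqp eqm].
have rE s m i : (1 <= s i)%N -> size (A_of s m i i) = (s i).+1.
  move=> si; apply/eqP; rewrite eqn_leq; apply/andP; split.
    apply/leq_sizeP => p lt_p; rewrite coefA_of eqxx.
    have [-> -> ->] : [/\ (p == 0)%N = false, (p == s i) = false & (p < s i)%N = false].
      by split; lia.
    by rewrite addr0 subr0.
  rewrite ltnNge; apply/negP => /leq_sizeP/(_ _ (leqnn _))/eqP.
  by rewrite coefA_of !eqxx ltnn gtn_eqF // subr0.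
have eqr i : r i = r' i.
  by apply: succn_inj; rewrite -(rE r (npos n)) // -(rE r' (npos n')) // eqp.
have nE s m i j p : (p < s i)%N ->
    (A_of s (nneg m) i j)`_p - (A_of s (npos m) i j)`_p = m i j p.
  by move=> lt_p; rewrite !coefA_of lt_p /npos /nneg /pos_part; lia.
split=> // i j p; have [lt_p|ge_p] := ltnP p (r i).
  by rewrite -(nE r) // -(nE r') -?eqr // eqp eqm.
by rewrite n0 ?n0' // -?eqr; lia.
Qed.

End Pairs.

HB.mixin Record Group_isSemifield P of monoid.Group P := {
  mulsC : commutative (@monoid.mul P);
  adds : P -> P -> P;
  addsC : commutative adds;
  addsA : associative adds;
  mulsDr : right_distributive (@monoid.mul P) adds
}.

#[short(type="semifieldType")]
HB.structure Definition Semifield := {P of Group_isSemifield P & monoid.Group P}.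

Definition powz (P : semifieldType) (x : P) (m : int) : P :=
  match m with Posz k => (x ^+ k)%g | Negz k => (x ^- k.+1)%g end.

Section Seeds.
Variables (R : finType) (P : semifieldType).

Definition skew (B : {ffun R * R -> int}) : bool :=
  [forall i, forall j, B (i, j) == - B (j, i)].

Record Yseed := YSeed {
  seedB : {ffun R * R -> int};
  seedy : {ffun R -> P};
  seed_skew : skew seedB
}.

Lemma Yseed_eq (s t : Yseed) : seedB s = seedB t -> seedy s = seedy t -> s = t.
Proof.
case: s t => [B y sk] [B' y' sk'] /= eqB eqy.
by subst B' y'; rewrite (bool_irrelevance sk sk').
Qed.

Lemma skewE (B : {ffun R * R -> int}) : skew B -> forall i j, B (i, j) = - B (j, i).
Proof. by move=> /forallP sk i j; apply/eqP/(forallP (sk i)). Qed.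

Definition mutB (k : R) (B : {ffun R * R -> int}) : {ffun R * R -> int} :=
  [ffun ij => let: (i, j) := ij in
    if (i == k) || (j == k) then - B (i, j)
    else B (i, j) + pos_part (- B (i, k)) * B (k, j)
         + B (i, k) * pos_part (B (k, j))].

Definition muty (k : R) (B : {ffun R * R -> int}) (y : {ffun R -> P}) :
  {ffun R -> P} :=
  [ffun i => if i == k then ((y k)^-1)%g
    else (y i * powz (y k) (pos_part (B (k, i)))
              * powz (adds 1 (y k)) (- B (k, i)))%g].

Lemma mutB_skew k B : skew B -> skew (mutB k B).
Proof.
move=> sk; apply/forallP => i; apply/forallP => j; apply/eqP.
rewrite !ffunE orbC; case: ifP => _; first by rewrite (skewE sk i j).
rewrite (skewE sk i j) (skewE sk j k) (skewE sk k i) !opprK; ring.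
Qed.

Definition mut (k : R) (s : Yseed) : Yseed :=
  YSeed (muty k (seedB s) (seedy s)) (mutB_skew k (seed_skew s)).

(* Composite of the [mut k] for k in A, in the order of [enum A]; the order is
   immaterial when [seedB s] vanishes on A x A. *)
Definition mut_set (A : {set R}) (s : Yseed) : Yseed := foldr mut s (enum A).

Lemma relabel_skew (nu : {perm R}) (B : {ffun R * R -> int}) : skew B ->
  skew [ffun ij : R * R => B ((nu^-1)%g ij.1, (nu^-1)%g ij.2)].
Proof.
move=> sk; apply/forallP => i; apply/forallP => j.
by rewrite !ffunE; apply/eqP/(skewE sk).
Qed.

Definition relabel (nu : {perm R}) (s : Yseed) : Yseed :=
  YSeed [ffun i => seedy s ((nu^-1)%g i)] (relabel_skew nu (seed_skew s)).

Lemma mutK k : involutive (mut k).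
Proof.
move=> s; have sk := skewE (seed_skew s).
have Bkk : seedB s (k, k) = 0 by have := sk k k; lia.
apply: Yseed_eq.
  apply/ffunP => -[i j]; rewrite /= !ffunE !eqxx orbT /=.
  case: ((i == k) || (j == k)); rewrite ?opprK //.
  have posB (m : int) : pos_part m = m + pos_part (- m) by rewrite /pos_part; lia.
  rewrite (posB (seedB s (i, k))) (posB (seedB s (k, j))); ring.
apply/ffunP => i; rewrite /= !ffunE !eqxx /=.
case: eqVneq => [->|_]; first by rewrite invgK.
move: (seedy s i) (seedy s k) => x y; move: (seedB s (k, i)) => b.
have addV : (adds 1 y^-1 = y^-1 * adds 1 y)%g.
  by rewrite mulsDr mulg1 mulVg addsC.
have cm (u v : P) : commute u v by apply: mulsC.
have eqV n : ((adds 1 y^-1) ^+ n = y ^- n * (adds 1 y) ^+ n)%g.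
  by rewrite addV expgMn ?expVgn.
rewrite opprK; case: (intP b) => [|n|n].
- by rewrite /pos_part oppr0 maxxx /= !mulg1.
- have -> : pos_part n.+1%:Z = n.+1 by rewrite /pos_part; lia.
  have -> : pos_part (- n.+1%:Z) = 0 by rewrite /pos_part; lia.
  rewrite -NegzE /= mulg1 eqV -!mulgA (mulgA (_ ^- _)%g) (cm (_ ^- _)%g (_ ^- _)%g).
  by rewrite -mulgA mulVg mulg1 mulgV mulg1.
- have -> : pos_part (- n.+1%:Z) = 0 by rewrite /pos_part; lia.
  have -> : pos_part (- - n.+1%:Z) = n.+1 by rewrite /pos_part; lia.
  rewrite opprK -NegzE /= mulg1 eqV invgM invgK expVgn -!mulgA.
  rewrite (mulgA (y ^- _)%g) (cm (y ^- _)%g (_ ^- _)%g) -mulgA mulVg mulg1.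
  by rewrite mulgV mulg1.
Qed.

Lemma mut_set_inj A : injective (mut_set A).
Proof.
move=> s t; rewrite /mut_set; elim: (enum A) => //= k e IH.
by move/(inv_inj (@mutK k)).
Qed.

Lemma relabel_inj nu : injective (relabel nu).
Proof.
move=> s t eq_st; have [eqB eqy] := (congr1 seedB eq_st, congr1 seedy eq_st).
apply: Yseed_eq.
  by apply/ffunP => -[i j]; have /ffunP/(_ (nu i, nu j)) := eqB; rewrite !ffunE /= !permK.
by apply/ffunP => i; have /ffunP/(_ (nu i)) := eqy; rewrite !ffunE /= !permK.
Qed.

End Seeds.

(* A monomial is encoded by its vector of exponents, so that the product of the
   multiplicative group is the pointwise sum. *)
Definition Trop (R : finType) : Type := {ffun R -> int}.

Section Tropical.
Variable R : finType.
Implicit Types a b c : {ffun R -> int}.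

HB.instance Definition _ := Choice.copy (Trop R) {ffun R -> int}.

Definition trop_add a b : {ffun R -> int} := [ffun r => Num.min (a r) (b r)].

Lemma trop_addC : commutative trop_add.
Proof. by move=> a b; apply/ffunP => r; rewrite !ffunE minC. Qed.

Lemma trop_addA : associative trop_add.
Proof. by move=> a b c; apply/ffunP => r; rewrite !ffunE minA. Qed.

Lemma trop_mulDr : right_distributive +%R trop_add.
Proof. by move=> a b c; apply/ffunP => r; rewrite !ffunE addr_minr. Qed.

HB.instance Definition _ := isGroup.Build (Trop R)
  (@addrA {ffun R -> int}) (@add0r _) (@addr0 _) (@addNr _) (@addrN _).
HB.instance Definition _ := Group_isSemifield.Build (Trop R)
  (@addrC {ffun R -> int}) trop_addC trop_addA trop_mulDr.

Definition expo (m : Trop R) (r : R) : int := (m : {ffun R -> int}) r.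

Definition trop_var (r : R) : Trop R := [ffun s => (s == r)%:R : int].

End Tropical.

Section YSystem.
Variables (N : nat) (r : 'I_N -> nat) (n : 'I_N -> 'I_N -> nat -> int).

Definition Rset : finType := {i : 'I_N & 'I_(r i)}.

Definition start_set : {set Rset} := [set x | val (tagged x) == 0%N].

Definition nu_fun (x : Rset) : Rset := Tagged (fun i => 'I_(r i)) (ord_pred (tagged x)).

Lemma nu_fun_inj : injective nu_fun.
Proof.
move=> [i p] [j q] /eqP; rewrite -tag_eqE /tag_eq /=.
case: eqP => //= eq_ij; subst j; rewrite tagged_asE => /eqP/ord_pred_inj.
by move->.
Qed.

(* [ord_pred] sends p > 0 to p - 1, and 0 to r i - 1. *)
Definition nu : {perm Rset} := perm nu_fun_inj.

Definition extz (m : 'I_N -> 'I_N -> nat -> int) i j (p : int) : int :=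
  if p is Posz k then m i j k else 0.

Definition Bmat : {ffun Rset * Rset -> int} :=
  [ffun xy : Rset * Rset =>
    let i := tag xy.1 in let p := val (tagged xy.1) in
    let j := tag xy.2 in let q := val (tagged xy.2) in
    - extz n i j (p%:Z - q%:Z) + extz n j i (q%:Z - p%:Z)
    + \sum_(k < N) \sum_(0 <= v < (minn p q).+1)
        (npos n i k (p - v) * nneg n j k (q - v)
         - nneg n i k (p - v) * npos n j k (q - v))].

Lemma Bmat_skew : skew Bmat.
Proof.
apply/forallP => x; apply/forallP => y; apply/eqP.
rewrite !ffunE /= minnC.
set S := (X in _ + X = _); set T := (X in _ = - (_ + X)).
suff -> : S = - T by ring.
rewrite -sumrN; apply: eq_bigr => k _.
by rewrite -sumrN; apply: eq_bigr => v _; ring.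
Qed.

(* The family y(u), u in Z; it is unique by [Ysystem_unique]. *)
Definition is_Ysystem (y : int -> {ffun Rset -> Trop Rset}) : Prop :=
  y 0 = [ffun x => trop_var x] /\
  forall u : int,
    YSeed (y (u + 1)) Bmat_skew
    = relabel nu (mut_set start_set (YSeed (y u) Bmat_skew)).

Lemma Ysystem_unique y y' : is_Ysystem y -> is_Ysystem y' -> y =1 y'.
Proof.
move=> [y0 yS] [y0' yS']; elim/int_rec => [|k IH|k IH]; first by rewrite y0.
  have /(congr1 (@seedy _ _)) := yS k%:Z; rewrite IH -yS' /=.
  by rewrite -addn1 PoszD.
have e : - k.+1%:Z + 1 = - k%:Z by lia.
have /esym := yS (- k.+1%:Z); rewrite e IH -e yS'.
by move/relabel_inj/mut_set_inj/(congr1 (@seedy _ _)).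
Qed.

Definition positive_reddening : Prop :=
  exists2 y, is_Ysystem y &
  exists2 u : nat, (0 < u)%N & forall x s, expo (y u%:Z x) s <= 0.

Definition negative_reddening : Prop :=
  exists2 y, is_Ysystem y &
  exists2 u : nat, (0 < u)%N & forall x s, expo (y (- u%:Z) x) s <= 0.

End YSystem.

Definition mx2 (a b c d : {poly int}) : 'M[{poly int}]_2 :=
  \matrix_(i < 2, j < 2)
    if i == 0 then (if j == 0 then a else b) else (if j == 0 then c else d).

(* Main.v *)
Require Import Defs.
From mathcomp Require Import all_boot all_order all_fingroup all_algebra.
From mathcomp Require Import ring zify.
Set Implicit Arguments.
Unset Strict Implicit.
Unset Printing Implicit Defensive.
Import Order.TTheory GRing.Theory Num.Theory.
Local Open Scope ring_scope.

(** One step of the Y-system is a relabelled pair of mutations that fixes the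
    exchange matrix [Bmat], and in the tropical semifield a mutation acts on
    exponent vectors by an explicit piecewise linear integer formula.  Hence
    y(u) is obtained from the unit vectors by finitely many integer operations
    and, each of the six index sets having at most 12 elements, reddening is
    settled by running the sequence until all exponents are nonpositive.

    Two points have to be argued rather than computed.  The sequence must exist
    for every integer u, which needs the step to fix [Bmat] and to be
    invertible: it is a composite of involutions and a bijection of the
    indices, and since the new exchange matrix does not depend on the
    coefficients, a single instance of B |-> B, computed at the initial seed,
    propagates to all u in both directions ([seedB_fixed], [Ysys_is_Ysystem]).
    And the computation must concern the actual seeds, indexed by the
    dependent pairs (i, p) with p < r i: flattening (i, p) to the number
    r_0 + ... + r_(i-1) + p turns a seed into two integer matrices stored as
    lists, and this encoding commutes with mutation and relabelling
    ([represents_mut], [represents_relabel]).  The check then evaluates inside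
    the logic ([reddening_by_computation]).

    The pair (r, n) underlying A is unique, so one pair treats all of them; the
    symplectic relation is four rational identities in z, valid at any nonzero
    z of any field ([symplectic_mx2]). *)

(** * Seeds in the tropical semifield as integer matrices *)

Definition table := seq (seq int).

Definition entry (t : table) (a b : nat) : int := nth 0 (nth [::] t a) b.

Definition tabulate (m : nat) (F : nat -> nat -> int) : table :=
  mkseq (fun a => mkseq (F a) m) m.

Lemma entry_tabulate m F a b :
  (a < m)%N -> (b < m)%N -> entry (tabulate m F) a b = F a b.
Proof. by move=> am bm; rewrite /entry !nth_mkseq. Qed.

(** A pair of tables stands for a seed: the first holds the exchange matrix, and
    row a of the second the exponents of y_a. *)
Definition table_mut (m k : nat) (t : table * table) : table * table :=
  let B := entry t.1 in let y := entry t.2 in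
  (tabulate m (fun a b => if (a == k) || (b == k) then - B a b
     else B a b + pos_part (- B a k) * B k b + B a k * pos_part (B k b)),
   tabulate m (fun a b => if a == k then - y k b
     else y a b + y k b * pos_part (B k a) - Num.min 0 (y k b) * B k a)).

(** Here [f] is the effect of the inverse relabelling on codes, so that entries
    are pulled back as in [relabel]. *)
Definition table_relabel (m : nat) (f : nat -> nat) (t : table * table) :
    table * table :=
  (tabulate m (fun a b => entry t.1 (f a) (f b)),
   tabulate m (fun a b => entry t.2 (f a) b)).

Section Trop_expo.
Variable R : finType.
Implicit Types (x y : Trop R) (s : R).

Lemma expoM x y s : expo (x * y)%g s = expo x s + expo y s.
Proof. by rewrite /expo ffunE. Qed.

Lemma expoV x s : expo (x^-1)%g s = - expo x s.
Proof. by rewrite /expo ffunE. Qed.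

Lemma expo1 s : expo (1%g : Trop R) s = 0.
Proof. by rewrite /expo ffunE. Qed.

Lemma expo_adds x y s : expo (adds x y) s = Num.min (expo x s) (expo y s).
Proof. by rewrite /expo ffunE. Qed.

Lemma expo_powz x z s : expo (powz x z) s = expo x s * z.
Proof.
have expoX k : expo (x ^+ k)%g s = expo x s * k%:Z.
  elim: k => [|k IH]; first by rewrite expg0 expo1 mulr0.
  by rewrite expgS expoM IH intS mulrDr mulr1.
by case: z => k; rewrite /powz ?NegzE ?expoV expoX ?mulrN.
Qed.

End Trop_expo.

Section Tables.
Variables (R : finType) (code : R -> nat) (m : nat).
Hypotheses (code_inj : injective code) (code_lt : forall x, (code x < m)%N).
Implicit Types (s : Yseed R (Trop R)) (t : table * table).

Definition represents s t : Prop :=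
  (forall x y, seedB s (x, y) = entry t.1 (code x) (code y)) /\
  (forall x w, expo (seedy s x) w = entry t.2 (code x) (code w)).

(** Multiplication of monomials adds exponents and [adds 1 y] truncates them at 0
    from above, so the exchange relation for y becomes the integer formula of
    [table_mut]; injectivity of [code] is what lets the test i = k be made on
    codes. *)
Lemma represents_mut k s t :
  represents s t -> represents (mut k s) (table_mut m (code k) t).
Proof.
case=> eB ey; split=> x y; rewrite entry_tabulate // /= ffunE !(inj_eq code_inj).
  by rewrite !eB.
case: eqP => _; first by rewrite expoV ey.
by rewrite !expoM !expo_powz expo_adds expo1 !ey !eB mulrN.
Qed.

Lemma represents_muts ks s t :
  represents s t ->
  represents (foldr (@mut R (Trop R)) s ks)
             (foldr (table_mut m) t [seq code k | k <- ks]).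
Proof. by move=> st; elim: ks => //= k ks; apply: represents_mut. Qed.

Lemma represents_muts_rev ks s t :
  represents s t ->
  represents (foldl (fun s' k => mut k s') s ks)
             (foldl (fun t' k => table_mut m k t') t [seq code k | k <- ks]).
Proof. by elim: ks s t => //= k ks IH s t st; apply/IH/represents_mut. Qed.

Lemma represents_relabel (g : {perm R}) f s t :
  (forall x, code ((g^-1)%g x) = f (code x)) ->
  represents s t -> represents (relabel g s) (table_relabel m f t).
Proof.
by move=> gf [eB ey]; split=> x y; rewrite entry_tabulate // /= ffunE /= -!gf.
Qed.

End Tables.

(** * Existence of the Y-system in both directions *)

Section Dynamics.
Variables (R : finType) (P : semifieldType) (A : {set R}) (g : {perm R}).
Implicit Types s : Yseed R P.

Definition advance s : Yseed R P := relabel g (mut_set A s).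

(** Mutations are involutive, so undoing [advance] applies the same mutations in
    the opposite order after the inverse relabelling. *)
Definition retreat s : Yseed R P :=
  foldl (fun s' k => mut k s') (relabel (g^-1)%g s) (enum A).

Lemma retreatK : cancel retreat advance.
Proof.
move=> s; have mutsK e s' : foldr (@mut R P) (foldl (fun z k => mut k z) s' e) e = s'.
  by elim: e s' => //= k e IH s'; rewrite IH mutK.
rewrite /advance /mut_set /retreat mutsK.
by apply: Yseed_eq; apply/ffunP; [case=> i j | move=> i]; rewrite !ffunE /= !invgK !permKV.
Qed.

Lemma advanceK : cancel advance retreat.
Proof.
by move=> s; apply/(@mut_set_inj _ _ A)/(@relabel_inj _ _ g)/retreatK.
Qed.

Lemma seedB_mut_eq k s s' : seedB s = seedB s' -> seedB (mut k s) = seedB (mut k s').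
Proof. by rewrite /mut /= => ->. Qed.

Lemma seedB_advance_eq s s' :
  seedB s = seedB s' -> seedB (advance s) = seedB (advance s').
Proof.
move=> eB; rewrite /advance /mut_set /=.
suff -> : seedB (foldr (@mut R P) s (enum A)) = seedB (foldr (@mut R P) s' (enum A)) by [].
by elim: (enum A) => //= k e /(seedB_mut_eq k).
Qed.

Lemma seedB_retreat_eq s s' :
  seedB s = seedB s' -> seedB (retreat s) = seedB (retreat s').
Proof.
move=> eB; rewrite /retreat.
have: seedB (relabel (g^-1)%g s) = seedB (relabel (g^-1)%g s') by rewrite /= eB.
by elim: (enum A) (relabel _ s) (relabel _ s') => //= k e IH t t' /(seedB_mut_eq k)/IH.
Qed.

(** Backwards, B is recovered from [retreat (advance s0)] = s0: the seed
    [advance s0] has the same exchange matrix as the current one, and only that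
    matrix decides the exchange matrix of the next seed. *)
Lemma seedB_fixed s0 : seedB (advance s0) = seedB s0 ->
  forall k, seedB (iter k advance s0) = seedB s0 /\ seedB (iter k retreat s0) = seedB s0.
Proof.
move=> fix0; elim=> //= k [IHa IHr]; split.
  by rewrite -[RHS]fix0; apply: seedB_advance_eq.
rewrite -[in RHS](advanceK s0); apply: seedB_retreat_eq.
by rewrite IHr fix0.
Qed.

End Dynamics.

Section YSystem.
Variables (N : nat) (r : 'I_N -> nat) (n : 'I_N -> 'I_N -> nat -> int).

Definition initial_seed : Yseed (Rset r) (Trop (Rset r)) :=
  YSeed [ffun x => trop_var x] (Bmat_skew r n).

Notation forth := (advance (start_set r) (nu r)).
Notation back := (retreat (start_set r) (nu r)).

Definition Ysys (u : int) : {ffun Rset r -> Trop (Rset r)} :=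
  match u with
  | Posz k => seedy (iter k forth initial_seed)
  | Negz k => seedy (iter k.+1 back initial_seed)
  end.

Lemma YsysN k : Ysys (- k%:Z) = seedy (iter k back initial_seed).
Proof. by case: k => [|k] //; rewrite -NegzE. Qed.

Lemma Ysys_is_Ysystem :
  seedB (forth initial_seed) = Bmat r n -> is_Ysystem n Ysys.
Proof.
move=> /(seedB_fixed (s0 := initial_seed)) eqB.
have seedE s : seedB s = Bmat r n -> YSeed (seedy s) (Bmat_skew r n) = s.
  by move=> eB; apply: Yseed_eq.
split=> // u; rewrite -/(forth _); case: u => k.
  have -> : k%:Z + 1 = k.+1 by lia.
  by rewrite !seedE; [rewrite iterS | case: (eqB k) | case: (eqB k.+1)].
have -> : Negz k + 1 = - k%:Z by rewrite NegzE; lia.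
by rewrite YsysN !seedE; [rewrite iterS retreatK | case: (eqB k.+1) | case: (eqB k)].
Qed.

End YSystem.

(** * Computing the Y-system from the integers r and n *)

Section Coordinates.
Variables (N : nat) (rs : seq nat) (c : nat -> nat -> nat -> int).

Notation row := (reshape_index rs).
Notation col := (reshape_offset rs).
Notation dim := (sumn rs).

(** The codes of nu^-1 (i, p) = (i, p + 1) and of nu (i, p) = (i, p - 1), with p
    taken modulo r_i. *)
Definition next_code (a : nat) : nat :=
  flatten_index rs (row a) ((col a).+1 %% nth 0%N rs (row a)).
Definition prev_code (a : nat) : nat :=
  flatten_index rs (row a) ((col a + nth 0%N rs (row a)).-1 %% nth 0%N rs (row a)).

(** The guard is there because subtraction of natural numbers truncates, whereas
    n_{ij;p-q} vanishes for p < q. *)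
Definition coef_diff (i j p q : nat) : int :=
  if (q <= p)%N then c i j (p - q) else 0.

Definition Bentry (a b : nat) : int :=
  let i := row a in let p := col a in let j := row b in let q := col b in
  let pos i k p := pos_part (c i k p) in let neg i k p := pos_part (- c i k p) in
  - coef_diff i j p q + coef_diff j i q p
  + foldr +%R 0 [seq foldr +%R 0
      [seq pos i k (p - v)%N * neg j k (q - v)%N - neg i k (p - v)%N * pos j k (q - v)%N
        | v <- iota 0 (minn p q).+1] | k <- iota 0 N].

Definition initial_tables : table * table :=
  (tabulate dim Bentry, tabulate dim (fun a b => (b == a)%:R)).

Definition start_codes : seq nat := [seq flatten_index rs i 0 | i <- iota 0 N].

Definition advance_tables (ks : seq nat) (t : table * table) : table * table :=
  table_relabel dim next_code (foldr (table_mut dim) t ks).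

Definition retreat_tables (ks : seq nat) (t : table * table) : table * table :=
  foldl (fun t' k => table_mut dim k t') (table_relabel dim prev_code t) ks.

Definition nonpos_table (t : table) : bool := all (all (fun e => e <= 0)) t.

(** Running over every order of the start codes covers whichever order [enum]
    lists the start set in, and so spares an appeal to the commutation of the
    mutations. *)
Definition reddening_check (u v : nat) : bool :=
  all (fun ks =>
    [&& (advance_tables ks initial_tables).1 == initial_tables.1,
        nonpos_table (iter u (advance_tables ks) initial_tables).2
      & nonpos_table (iter v (retreat_tables ks) initial_tables).2])
  (permutations start_codes).

Lemma entry_nonpos t a b : nonpos_table t -> entry t a b <= 0.
Proof.
move=> /(all_nthP [::]) t0; rewrite /entry.
have [/t0/(all_nthP 0) ta|ga] := ltnP a (size t); last first.
  by rewrite (nth_default [::]) ?nth_nil.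
by have [/ta //|gb] := ltnP b (size (nth [::] t a)); rewrite nth_default.
Qed.

Section Correctness.
Variables (r : 'I_N -> nat) (n : 'I_N -> 'I_N -> nat -> int).
Hypotheses (r_gt0 : forall i, (0 < r i)%N) (rE : forall i, r i = nth 0%N rs i).
Hypothesis nE : forall i j p, n i j p = c i j p.

Definition code (x : Rset r) : nat := flatten_index rs (tag x) (tagged x).

Lemma tagged_lt (x : Rset r) : (tagged x < nth 0 rs (tag x))%N.
Proof. by rewrite -rE. Qed.

Lemma code_row x : row (code x) = tag x.
Proof. exact/flatten_indexKl/tagged_lt. Qed.

Lemma code_col x : col (code x) = tagged x.
Proof. exact/flatten_indexKr/tagged_lt. Qed.

Lemma code_inj : injective code.
Proof.
move=> x y e; have := code_row x; have := code_col x.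
rewrite e code_col code_row; case: x y {e} => [i p] [j q] /= eqp /val_inj eqi.
by subst j; congr existT; apply: val_inj.
Qed.

Lemma code_lt x : (code x < dim)%N.
Proof. exact/flatten_indexP/tagged_lt. Qed.

Lemma code_nuV x : code ((nu r)^-1%g x) = next_code (code x).
Proof.
have -> : (nu r)^-1%g x = Tagged (fun i => 'I_(r i)) (ordS (tagged x)).
  apply: (canLR (permK _)); rewrite permE; case: x => i p.
  by rewrite /nu_fun /= ordSK.
by rewrite /next_code code_row code_col -rE.
Qed.

Lemma code_nu x : code (nu r x) = prev_code (code x).
Proof. by rewrite permE /prev_code code_row code_col -rE. Qed.

Lemma extz_coef_diff i j (p q : nat) : extz n i j (p%:Z - q%:Z) = coef_diff i j p q.
Proof.
rewrite /coef_diff; case: leqP => [le_qp|lt_pq]; first by rewrite subzn // /extz nE.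
have -> : p%:Z - q%:Z = Negz (q - p).-1 by rewrite NegzE; lia.
by [].
Qed.

Lemma represents_initial : represents code (initial_seed r n) initial_tables.
Proof.
split=> x y; rewrite entry_tabulate ?code_lt //=; last first.
  by rewrite /expo !ffunE (inj_eq code_inj).
rewrite ffunE /= /Bentry !code_row !code_col !extz_coef_diff; congr (_ + _).
rewrite foldrE big_map -[N in iota _ N]subn0 big_mkord.
apply: eq_bigr => k _; rewrite foldrE big_map.
by apply: eq_big_seq => v _; rewrite /npos /nneg !nE.
Qed.

(** The start set is { (i, 0) }, so its enumeration, in whatever order, yields a
    permutation of the codes of these elements. *)
Lemma start_set_codes :
  [seq code x | x <- enum (start_set r)] \in permutations start_codes.
Proof.
rewrite mem_permutations /start_codes -val_enum_ord -map_comp.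
pose x0 i : Rset r := Tagged (fun i => 'I_(r i)) (Ordinal (r_gt0 i)).
rewrite (_ : map _ (enum 'I_N) = [seq code x | x <- [seq x0 i | i <- enum 'I_N]]).
  2: by rewrite -map_comp.
apply/perm_map/uniq_perm; first exact: enum_uniq.
  by rewrite map_inj_uniq ?enum_uniq // => i j /(congr1 tag).
move=> x; rewrite mem_enum inE; apply/eqP/mapP => [px|[i _ ->]] //.
exists (tag x); first by rewrite mem_enum.
by case: x px => i p /= p0; congr existT; apply: val_inj.
Qed.

Lemma reddening_by_computation u v : (0 < u)%N -> (0 < v)%N ->
  reddening_check u v -> positive_reddening r n /\ negative_reddening r n.
Proof.
move=> u0 v0 /allP/(_ _ start_set_codes)/and3P[/eqP fixB posu negv].
set ks := map _ _ in fixB posu negv.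
have fw s t : represents code s t ->
    represents code (advance (start_set r) (nu r) s) (advance_tables ks t).
  move=> st; apply: (represents_relabel code_lt code_nuV).
  exact: (represents_muts code_inj code_lt).
have bw s t : represents code s t ->
    represents code (retreat (start_set r) (nu r) s) (retreat_tables ks t).
  move=> st; apply: (represents_muts_rev code_inj code_lt).
  by apply: (represents_relabel code_lt) st => x; rewrite invgK code_nu.
have st0 := represents_initial.
have sys : is_Ysystem n (Ysys r n).
  apply: Ysys_is_Ysystem; apply/ffunP => -[x y].
  have [-> _] := fw _ _ st0; rewrite fixB.
  by have [<- _] := st0.
split; exists (Ysys r n) => //; [exists u => // x s | exists v => // x s].
  suff [_ ->] : represents code (iter u (advance (start_set r) (nu r)) (initial_seed r n))
    (iter u (advance_tables ks) initial_tables) by apply: entry_nonpos.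
  by elim: u {u0 posu} => //= k; apply: fw.
rewrite YsysN.
suff [_ ->] : represents code (iter v (retreat (start_set r) (nu r)) (initial_seed r n))
  (iter v (retreat_tables ks) initial_tables) by apply: entry_nonpos.
by elim: v {v0 negv} => //= k; apply: bw.
Qed.

End Correctness.
End Coordinates.

(** * Pairs of 2 x 2 matrices given by coefficient lists *)

Section TwoByTwo.
Variables (r0 r1 : nat) (c00 c01 c10 c11 : seq int).

Definition coef2 (i j p : nat) : int :=
  nth 0 (if i == 0%N then (if j == 0%N then c00 else c01)
         else (if j == 0%N then c10 else c11)) p.

Definition radius2 (i : 'I_2) : nat := nth 0%N [:: r0; r1] i.
Definition coefs2 (i j : 'I_2) (p : nat) : int := coef2 i j p.

Definition supported (r : nat) (s : seq int) : bool :=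
  (size s <= r)%N && (nth 0 s 0 == 0).

Lemma supportedP r s p : supported r s -> ~~ (0 < p < r)%N -> nth 0 s p = 0.
Proof.
case/andP=> sz /eqP s0; case: p => [|p] // /=; rewrite -leqNgt => rp.
by rewrite nth_default // (leq_trans sz).
Qed.

Definition supported2 : bool :=
  [&& (0 < r0)%N, (0 < r1)%N, supported r0 c00, supported r0 c01,
      supported r1 c10 & supported r1 c11].

Lemma coefs2_in_Y0 : supported2 -> in_Y0 radius2 coefs2.
Proof.
case/and5P=> ? ? s00 s01 /andP[s10 s11]; split.
  by case=> [[|[|i]]].
by case=> [[|[|i]] //= ?] [[|[|j]] //= ?] p; apply: supportedP.
Qed.

Lemma nth_pos_part (s : seq int) p :
  pos_part (nth 0 s p) = nth 0 [seq pos_part a | a <- s] p.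
Proof.
have [ps|sp] := ltnP p (size s); first by rewrite (nth_map 0).
by rewrite !nth_default ?size_map // /pos_part maxxx.
Qed.

Lemma A_of_Poly N (R : 'I_N -> nat) m i j (s : seq int) :
  (size s <= R i)%N -> (forall p, m i j p = nth 0 s p) ->
  A_of R m i j = (1 + 'X^(R i)) *+ (i == j) - Poly s.
Proof.
move=> sR ms; apply/polyP => p; rewrite coefA_of ms !coefE; congr (_ - _).
  by case: (i == j).
by case: ltnP => // Rp; rewrite nth_default // (leq_trans sR).
Qed.

Lemma mx2E (M : 'M[{poly int}]_2) a b c d :
  M 0 0 = a -> M 0 1 = b -> M 1 0 = c -> M 1 1 = d -> M = mx2 a b c d.
Proof.
move=> <- <- <- <-; apply/matrixP => i j; rewrite mxE.
by case: i => [[|[|i]] ?] //; case: j => [[|[|j]] ?] //=;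
  congr (M _ _); apply: val_inj.
Qed.

Notation pos_list s := [seq pos_part a | a <- s].
Notation neg_list s := [seq pos_part a | a <- [seq - b | b <- s]].

Lemma nth_opp (s : seq int) p : - nth 0 s p = nth 0 [seq - b | b <- s] p.
Proof.
have [ps|sp] := ltnP p (size s); first by rewrite (nth_map 0).
by rewrite !nth_default ?size_map.
Qed.

Lemma Apm2 :
  supported2 ->
  Apm radius2 coefs2 =
  (mx2 (1 + 'X^r0 - Poly (pos_list c00)) (- Poly (pos_list c01))
       (- Poly (pos_list c10)) (1 + 'X^r1 - Poly (pos_list c11)),
   mx2 (1 + 'X^r0 - Poly (neg_list c00)) (- Poly (neg_list c01))
       (- Poly (neg_list c10)) (1 + 'X^r1 - Poly (neg_list c11))).
Proof.
case/and5P=> _ _ /andP[s00 _] /andP[s01 _] /andP[/andP[s10 _] /andP[s11 _]].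
have szP s k : (size s <= k)%N -> (size (pos_list s) <= k)%N by rewrite size_map.
have szN s k : (size s <= k)%N -> (size (neg_list s) <= k)%N by rewrite !size_map.
have nthP (s : seq int) p : pos_part (nth 0 s p) = nth 0 (pos_list s) p.
  exact: nth_pos_part.
have nthN (s : seq int) p : pos_part (- nth 0 s p) = nth 0 (neg_list s) p.
  by rewrite -nth_pos_part -nth_opp.
congr (_, _); apply: mx2E.
- by apply: (A_of_Poly (s := pos_list c00)); [exact: szP | exact: nthP].
- by rewrite (A_of_Poly (s := pos_list c01)) ?sub0r //; [exact: szP | exact: nthP].
- by rewrite (A_of_Poly (s := pos_list c10)) ?sub0r //; [exact: szP | exact: nthP].
- by apply: (A_of_Poly (s := pos_list c11)); [exact: szP | exact: nthP].
- by apply: (A_of_Poly (s := neg_list c00)); [exact: szN | exact: nthN].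
- by rewrite (A_of_Poly (s := neg_list c01)) ?sub0r //; [exact: szN | exact: nthN].
- by rewrite (A_of_Poly (s := neg_list c10)) ?sub0r //; [exact: szN | exact: nthN].
- by apply: (A_of_Poly (s := neg_list c11)); [exact: szN | exact: nthN].
Qed.

(** By [Apm_inj] the integers read off from the lists are the only ones that give
    A, so it is enough to run the check on the lists. *)
Lemma reddening_pair A u v :
  supported2 ->
  Apm radius2 coefs2 = A -> symplectic A ->
  [&& (0 < u)%N, (0 < v)%N & reddening_check 2 [:: r0; r1] coef2 u v] ->
  in_Y A /\
  forall (r : 'I_2 -> nat) (n : 'I_2 -> 'I_2 -> nat -> int),
    in_Y0 r n -> Apm r n = A ->
    positive_reddening r n /\ negative_reddening r n.
Proof.
move=> /coefs2_in_Y0 Y0 eA sA /and3P[u0 v0 chk].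
split; first by split=> //; exists radius2, coefs2.
move=> r n Y0' eA'; have [er en] := Apm_inj Y0' Y0 (etrans eA' (esym eA)).
by apply: reddening_by_computation chk => //; case: Y0'.
Qed.

End TwoByTwo.

(** * The symplectic relation *)

Section Evaluation.
Variables (F : fieldType) (x : F).

(** Over the field of rational functions this is [eval_frac]; a general field is
    used because the relation is an identity in z alone. *)
Definition eval_int (p : {poly int}) : F := (map_poly intr p).[x].

Lemma eval_intE :
  (eval_int 0 = 0) * (eval_int 1 = 1) * {morph eval_int : p / - p} *
  {morph eval_int : p q / p + q} * (forall k, eval_int 'X^k = x ^+ k) *
  (eval_int 'X = x).
Proof.
do !split; rewrite /eval_int.
- by rewrite rmorph0 horner0.
- by rewrite rmorph1 hornerC.
- by move=> p; rewrite rmorphN hornerN.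
- by move=> p q; rewrite rmorphD hornerD.
- by move=> k; rewrite map_polyXn hornerXn.
- by rewrite map_polyX hornerX.
Qed.

End Evaluation.

(** Asking for the identities in every field keeps the concrete field of
    fractions out of the algebra: they then follow by clearing denominators in
    an abstract field, z being invertible. *)
Lemma symplectic_mx2 (a b c d a' b' c' d' : {poly int}) :
  (forall (F : fieldType) (z : F), z != 0 ->
    let e := eval_int z in let f := eval_int z^-1 in
    [/\ e a * f a' + e b * f b' = e a' * f a + e b' * f b,
       e a * f c' + e b * f d' = e a' * f c + e b' * f d,
       e c * f a' + e d * f b' = e c' * f a + e d' * f b &
       e c * f c' + e d * f d' = e c' * f c + e d' * f d]) ->
  symplectic (mx2 a b c d, mx2 a' b' c' d').
Proof.
have z0 : tofrac ('X : {poly int}) != 0 by rewrite tofrac_eq0 polyX_eq0.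
case/(_ _ _ z0) => e00 e01 e10 e11; apply/matrixP => i j.
rewrite !mxE !big_ord_recl !big_ord0 !mxE /= !addr0.
by case: i => [[|[|i]] ?] //; case: j => [[|[|j]] ?].
Qed.

(** * The six pairs *)

Lemma pos_partE : (pos_part 0 = 0) * (pos_part 1 = 1) * (pos_part (-1) = 0).
Proof. by []. Qed.

Ltac verify_pair :=
  match goal with
  | |- Apm _ _ = _ =>
    rewrite Apm2 // /= !(oppr0, opprK, pos_partE) !cons_poly_def !(polyC0, polyC1);
    congr (mx2 _ _ _ _, mx2 _ _ _ _); ring
  | |- symplectic _ =>
    apply: symplectic_mx2 => F z z0; rewrite /= !eval_intE; split; by field
  | |- is_true _ => by vm_compute
  end.

Theorem theorem2p8
  (A : 'M[{poly int}]_2 * 'M[{poly int}]_2)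
  (hA : A \in [::
    (mx2 (1 + 'X^2) (- 'X) (- 'X) (1 + 'X^2),
     mx2 (1 + 'X^2) 0 0 (1 + 'X^2));
    (mx2 (1 + 'X^2) (- 'X) (- 'X - 'X^5) (1 + 'X^6),
     mx2 (1 + 'X^2) 0 (- 'X^3) (1 + 'X^6));
    (mx2 (1 + 'X^2) (- 'X) (- 'X - 'X^5 - 'X^9) (1 + 'X^10),
     mx2 (1 + 'X^2) 0 (- 'X^3 - 'X^7) (1 + 'X^10));
    (mx2 (1 + 'X^2) (- 'X) (- 'X) (1 + 'X^2),
     mx2 (1 + 'X^2 - 'X) 0 0 (1 + 'X^2 - 'X));
    (mx2 (1 + 'X^2) (- 'X) (- 'X - 'X^2) (1 + 'X^3),
     mx2 (1 + 'X^2 - 'X) 0 0 (1 + 'X^3));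
    (mx2 (1 + 'X^2) (- 'X) (- 'X) (1 + 'X^2 - 'X),
     mx2 (1 + 'X^2) 0 0 (1 + 'X^2))]) :
  in_Y A /\
  forall (r : 'I_2 -> nat) (n : 'I_2 -> 'I_2 -> nat -> int),
    in_Y0 r n -> Apm r n = A ->
    positive_reddening r n /\ negative_reddening r n.
Proof.
move: hA; rewrite !inE.
move=> /or4P[/eqP-> | /eqP-> | /eqP-> | /or3P[/eqP-> | /eqP-> | /eqP->]].
(* The last two numbers given to [reddening_pair] are the least numbers of steps,
   forwards and backwards, after which all exponents are nonpositive. *)
- apply: (@reddening_pair 2 2 [::] [:: 0; 1] [:: 0; 1] [::] _ 3 2); verify_pair.
- apply: (@reddening_pair 2 6 [::] [:: 0; 1]
    [:: 0; 1; 0; -1; 0; 1] [::] _ 8 6); verify_pair.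
- apply: (@reddening_pair 2 10 [::] [:: 0; 1]
    [:: 0; 1; 0; -1; 0; 1; 0; -1; 0; 1] [::] _ 18 10); verify_pair.
- apply: (@reddening_pair 2 2 [:: 0; -1] [:: 0; 1]
    [:: 0; 1] [:: 0; -1] _ 3 3); verify_pair.
- apply: (@reddening_pair 2 3 [:: 0; -1] [:: 0; 1]
    [:: 0; 1; 1] [::] _ 5 3); verify_pair.
- apply: (@reddening_pair 2 2 [::] [:: 0; 1] [:: 0; 1] [:: 0; 1] _ 5 2); verify_pair.
Qed.
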